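(* For any integer $k\ge1$, $$\zeta_{2\{1\}_{2k-1}}^{\{\ell s\}_{k-1}\ell}=\zeta_{\{2\}_k1}^{\{\ell\}_k}=2\,\zeta(2k+1).$$
   Context: For a finite word $\sigma$, $\{\sigma\}_j$ denotes the concatenation of $j$ copies of $\sigma$, with $\{\sigma\}_0=\emptyset$. For integers $b_1\ge2$, $b_2,\ldots,b_p\ge1$ and letters $a_1,\ldots,a_{p-1}\in\{\ell,s\}$, the extended multiple zeta value is $$\zeta_{b_1b_2\cdots b_p}^{a_1a_2\cdots a_{p-1}}=\sum\frac{1}{k_1^{b_1}k_2^{b_2}\cdots k_p^{b_p}},$$ where the sum is over integers $k_1,\ldots,k_p\ge1$ such that, for each $j=1,\ldots,p-1$, $k_j>k_{j+1}$ if $a_j=s$ and $k_j\ge k_{j+1}$ if $a_j=\ell$. $\zeta(2k+1)$ denotes a value of the Riemann zeta function. *)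

(* Defs.v *)
From mathcomp Require Import all_boot all_order all_algebra.
From mathcomp Require Import all_classical all_reals all_analysis.
Set Implicit Arguments.
Unset Strict Implicit.
Unset Printing Implicit Defensive.
Import Order.TTheory GRing.Theory Num.Theory.
Import numFieldNormedType.Exports.

Local Open Scope classical_set_scope.
Local Open Scope ring_scope.

Inductive letter := Ell | Ess.

Definition letter_rel (a : letter) : rel nat :=
  match a with
  | Ell => fun m n => (n <= m)%N
  | Ess => fun m n => (n < m)%N
  end.

Definition rep (T : Type) (j : nat) (w : seq T) : seq T := flatten (nseq j w).

(* Positions are numbered from 0: k_1, ..., k_p is stored as
   nth 0 k 0, ..., nth 0 k (p - 1), and likewise for b and a. *)
Definition mzv_index (b : seq nat) (a : seq letter) :
    set ((size b).-tuple nat) :=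
  [set k | (forall i, (i < size b)%N -> (1 <= nth 0%N k i)%N) /\
           (forall j, (j.+1 < size b)%N ->
              letter_rel (nth Ell a j) (nth 0%N k j) (nth 0%N k j.+1))].

Arguments mzv_index : clear implicits.

(* An unordered sum of nonnegative terms, with value +oo on divergence.
   It is meant for size b = (size a).+1, with head at least 2 and all other
   entries of b at least 1. *)
Definition mzv (R : realType) (b : seq nat) (a : seq letter) : \bar R :=
  (\esum_(k in mzv_index b a)
     (\prod_(i < size b) ((nth 0%N k i)%:R ^+ nth 0%N b i)^-1)%:E)%E.

(* Meaningful for integer s >= 2; the lim of a divergent sequence is junk. *)
Definition zeta (R : realType) (s : nat) : R :=
  limn (series (fun n : nat => (n.+1%:R ^+ s)^-1 : R)).

(* Main.v *)
Require Import Defs.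
From mathcomp Require Import all_boot all_order all_algebra.
From mathcomp Require Import all_classical all_reals all_analysis.
From mathcomp Require Import ring.
Import Order.TTheory GRing.Theory Num.Theory.
Import numFieldNormedType.Exports.
Local Open Scope ring_scope.

(** Both series have nonnegative terms, so sums may be rearranged freely in
    the extended reals.  Each is expanded by its largest index: [coef R b a n]
    is the finite inner sum with k_1 = n, and it is built from the empty word
    by operators [step e a] on sequences, one for each exponent [e] and letter
    [a].

    The equality of the two series is a duality, obtained by the connected sum
    method of Seki and Yamamoto.  With the connector 1 / 'C(n + m, n), put
      <u, v> = \sum_n \sum_m u_n v_m / 'C(n + m, n).
    The telescoping identity
      \sum_(p > m) 1 / ('C(n + p, n) p) = 1 / ('C(n + m, n) n)
    for n > 0 ([connector_sum]) says that division by the index,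
    X0 = [divn_seq], is adjoint to the strict summation X1 = [step 1 Ess], up
    to a vanishing condition at index 0; hence the weak summation
    Z = [step 1 Ell] = X0 + X1 is self-adjoint on sequences
    that vanish at 0.  The left series is
    <X0 (Z X1)^k delta0, delta0>.  Moving the operators one at a time to the
    other side turns it into <delta0, (X0 Z)^k X1 delta0>, the right series
    ([sum_duality]).

    The value comes from the ratios c(n, j) = 'C(n, j) / 'C(n + j, j), which
    satisfy c(n, j) / n^2 = (c(n, j) - c(n - 1, j)) / j^2 for n, j > 0.
    Summing this telescoping relation over n shows, by induction on k, that
    the inner sum of the right series at n is
      \sum_j (2 j / j^(2k)) c(n, j) / n^2
    ([iter_step2_bin_ratio]).  Since c(n, j) tends to 1 in n, summing over n
    first telescopes to 1 / j^2, and what is left is \sum_j 2 / j^(2k+1). *)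

(** * Series in the extended reals *)

Lemma nneseries_finsupp {R : realType} {f : nat -> \bar R} N :
  (forall i, 0 <= f i)%E -> (forall i, (N <= i)%N -> f i = 0%E) ->
  (\sum_(i <oo) f i = \sum_(i < N) f i)%E.
Proof.
move=> f0 fN; rewrite (nneseries_split 0 N)// add0n.
by rewrite eseries0 ?adde0 ?big_mkord// => i Ni _; exact: fN.
Qed.

Lemma nneseries_telescope (R : realType) (F : nat -> R) (l : R) m :
  (F @ \oo --> l)%classic -> {homo F : x y / (x <= y)%N >-> x <= y} ->
  (\sum_(m <= k <oo) (F k.+1 - F k)%:E = (l - F m)%:E)%E.
Proof.
move=> Fl ndF.
have El : limn (EFin \o F) = l%:E.
  by apply/cvg_lim => //; apply: cvg_EFin => //; exact: nearW.
under eq_eseriesr do rewrite EFinB.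
by rewrite nondecreasing_telescope_sumey ?El.
Qed.

(** * Expansion of a multiple zeta value by its largest index *)

Definition nonneg_seq {R : realType} (u : nat -> R) := forall n, 0 <= u n.

(** The empty word is given the sequence concentrated at index 0, so that adding
    a letter is the same operation for the innermost letter as for the
    others: index 0 lies below every positive index, strictly or weakly. *)
Definition delta0 (R : realType) (n : nat) : R := (n == 0)%:R.

Definition step {R : realType} (e : nat) (a : letter) (u : nat -> R) (n : nat) : R :=
  (n%:R ^+ e)^-1 * \sum_(m < n.+1 | letter_rel a n m) u m.

(** At n = 0 a nonempty word of positive exponents gives 0, because 0^-1 = 0;
    this is how the condition k_i >= 1 is encoded. *)
Fixpoint coef (R : realType) (b : seq nat) (a : seq letter) : nat -> R :=
  if b is e :: b' then step e (head Ell a) (coef R b' (behead a)) else delta0 R.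

Lemma step_ge0 (R : realType) e a (u : nat -> R) :
  nonneg_seq u -> nonneg_seq (step e a u).
Proof.
by move=> u0 n; rewrite mulr_ge0 ?sumr_ge0// invr_ge0 exprn_ge0.
Qed.

Lemma delta0_ge0 (R : realType) n : 0 <= delta0 R n.
Proof. exact: ler0n. Qed.

Lemma coef_ge0 (R : realType) b a n : 0 <= coef R b a n.
Proof.
by elim: b a n => [|e b IH] a n /=; [exact: delta0_ge0|exact: step_ge0].
Qed.

Definition mzv_summand (R : realType) (b : seq nat) (k : seq nat) : R :=
  \prod_(i < size b) (nth 0%N k i)%:R ^- nth 0%N b i.

Lemma mzv_summand_ge0 (R : realType) b k : 0 <= mzv_summand R b k.
Proof. by apply: prodr_ge0 => i _; rewrite invr_ge0 exprn_ge0. Qed.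

Definition headed_index (b : seq nat) (a : seq letter) (n : nat) :
    set ((size b).-tuple nat) :=
  [set k | mzv_index b a k /\ head 0%N k = n]%classic.

(** When [b] is empty the only tail is the empty tuple, of head 0 by default,
    which the letter relation allows below n > 0; this matches [delta0]. *)
Lemma headed_index_cons e b a n : (0 < n)%N ->
  headed_index (e :: b) a n =
  (\bigcup_(m in [set m | ((m < n.+1) && letter_rel (head Ell a) n m)%N])
     (fun k : (size b).-tuple nat => [tuple of n :: k]) @`
       headed_index b (behead a) m)%classic.
Proof.
move=> n0; apply/seteqP; split=> [k [[k1 kr] kn]|y [m /= /andP[mn rm]]].
  exists (head 0%N (behead k)).
    have rk : letter_rel (head Ell a) n (head 0%N (behead k)).
      case: b k k1 kr kn => [|e' b] k k1 kr kn.
        have -> : behead k = [::] by apply: size0nil; rewrite size_behead size_tuple.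
        by case: (head _ _).
      by have := kr 0%N isT; rewrite !nth0 kn -nth_behead nth0.
    by rewrite /= rk andbT; move: rk; case: (head _ _) => //= /ltnW.
  have nk : n :: behead k = k by rewrite -kn; case: (tval k) (size_tuple k).
  exists [tuple of behead k]; last by apply: val_inj; rewrite /= nk.
  split=> //; split=> [i ib|j jb] /=; first by rewrite nth_behead; exact: k1.
  by rewrite !nth_behead; exact: kr.
case=> k [[k1 kr] km] <-; split=> //; split=> [[|i] ib//|[|j] jb].
- exact: k1 i ib.
- by rewrite nth0 /= nth0 km.
- by have := kr j jb; rewrite nth_behead.
Qed.

(** The factor [c] makes the induction go through: it absorbs the power of the
    outermost index, so that no scalar has to be moved out of an infinite
    sum. *)
Lemma esum_headed_index (R : realType) b a n (c : R) : 0 <= c ->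
  all (leq 1) b ->
  (\esum_(k in headed_index b a n) (c * mzv_summand R b k)%:E
    = (c * coef R b a n)%:E)%E.
Proof.
elim: b a n c => [|e b IH] a n c c0 /=.
  move=> _; rewrite /delta0; case: n => [|n].
    rewrite (_ : headed_index _ _ _ = [set ([tuple] : (size (@nil nat)).-tuple nat)]%classic).
      by rewrite esum_set1 /mzv_summand ?big_ord0// lee_fin mulr1.
    apply/seteqP; split=> k /=; first by rewrite (tuple0 k).
    by move=> ->.
  rewrite mulr0 (_ : headed_index _ _ _ = set0) ?esum_set0//.
  by apply/seteqP; split=> k //= -[_]; rewrite (tuple0 k).
case/andP=> e1 b1; case: (posnP n) => [->|n0].
  (* No admissible index has head 0, and the coefficient is 0^-1 = 0. *)
  rewrite /step expr0n gtn_eqF// invr0 mul0r mulr0.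
  rewrite (_ : headed_index _ _ _ = set0) ?esum_set0//.
  by apply/seteqP; split=> k //= -[[/(_ 0%N isT) + _]]; rewrite nth0 => /[swap] ->.
rewrite headed_index_cons// esum_bigcupT; last 2 first.
- move=> i j _ _ [_ [[k [_ <-] <-]]] [k' [_ <-]] /(congr1 val) [].
  by move=> ->.
- by move=> k; rewrite lee_fin mulr_ge0// mzv_summand_ge0.
under eq_esum => m _.
  rewrite esum_image; last by move=> k k' _ _ /(congr1 val) [] /val_inj.
  under eq_esum => k _.
    rewrite /mzv_summand big_ord_recl /= mulrA.
    over.
  rewrite IH ?mulr_ge0// ?invr_ge0 ?exprn_ge0//.
  over.
rewrite -(@nneseries_esum R (fun m => (c * n%:R ^- e * coef R b (behead a) m)%:E)
  (fun m => (m < n.+1)%N && letter_rel (head Ell a) n m)); last first.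
  move=> m _.
  by rewrite lee_fin !mulr_ge0 ?invr_ge0 ?exprn_ge0 ?coef_ge0.
rewrite eseries_mkcond (nneseries_finsupp n.+1); first last.
- by move=> i; rewrite leqNgt => /negbTE ->.
- move=> i; case: ifP => // _.
  by rewrite lee_fin !mulr_ge0 ?invr_ge0 ?exprn_ge0 ?coef_ge0.
under eq_bigr => i _ do rewrite ltn_ord /=.
rewrite -big_mkcond sumEFin /step mulrA; congr (_%:E).
by rewrite mulr_sumr.
Qed.

Lemma mzvE (R : realType) b a : all (leq 1) b ->
  mzv R b a = (\sum_(n <oo) (coef R b a n)%:E)%E.
Proof.
move=> b1; rewrite /mzv.
rewrite (_ : mzv_index b a =
   \bigcup_(n in setT) headed_index b a n)%classic; last first.
  by apply/seteqP; split=> [k kI|k [n _ [kI _]]//]; exists (head 0%N k).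
rewrite esum_bigcupT; last 2 first.
- by move=> i j _ _ [k [[_ <-] [_ <-]]].
- by move=> k; rewrite lee_fin mzv_summand_ge0.
rewrite nneseries_esumT; last by move=> n; rewrite lee_fin coef_ge0.
apply: eq_esum => n _; rewrite -[in RHS](mul1r (coef R b a n)).
rewrite -esum_headed_index//.
by apply: eq_esum => k _; rewrite mul1r.
Qed.

(** * The connected sum and the duality *)

Definition pairing {R : realType} (u v : nat -> R) : \bar R :=
  (\sum_(n <oo) \sum_(m <oo) (u n * v m / 'C(n + m, n)%:R)%:E)%E.

Lemma ltn_bin_add n p : (p < 'C(n.+1 + p, n.+1))%N.
Proof.
elim: p => [|p IH]; first by rewrite addn0 binn.
by rewrite addnS binS -[p.+2]addn1 leq_add// bin_gt0 leqW// leq_addr.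
Qed.

(** Telescoping: 1 / ('C(n + p, n) p) is 1 / n times the decrease of
    1 / 'C(n + p, n) from p - 1 to p, and 1 / 'C(n + p, n) tends to 0 as soon as
    n > 0. *)
Lemma connector_sum {R : realType} n m : (0 < n)%N ->
  (\sum_(m.+1 <= p <oo) (('C(n + p, n)%:R : R)^-1 / p%:R)%:E
     = (('C(n + m, n)%:R : R)^-1 / n%:R)%:E)%E.
Proof.
move=> n0; pose F (p : nat) : R := - (('C(n + p.-1, n)%:R)^-1 / n%:R).
have nR0 : n%:R != 0 :> R by rewrite pnatr_eq0 -lt0n.
(* At p = 0 both sides vanish: 0^-1 = 0, and F 1 = F 0 as 0.-1 = 0. *)
have dF p : ('C(n + p, n)%:R : R)^-1 / p%:R = F p.+1 - F p.
  rewrite /F /=; case: p => [|p] /=; first by rewrite subrr invr0 mulr0.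
  have /(congr1 (fun i => i%:R : R)) := mul_bin_down (n + p.+1) n.
  rewrite addnS /= subSn ?leq_addr// addKn !natrM => E.
  have C0 : 'C(n + p, n)%:R != 0 :> R by rewrite pnatr_eq0 -lt0n bin_gt0 leq_addr.
  have p0 : p.+1%:R != 0 :> R by rewrite pnatr_eq0.
  have np0 : n%:R + p.+1%:R != 0 :> R by rewrite -natrD addnS pnatr_eq0.
  move: E; rewrite -addnS natrD => /(canLR (mulKf p0)) <-.
  by field; rewrite nat1r nR0 C0 p0 np0.
transitivity (\sum_(m.+1 <= p <oo) (F p.+1 - F p)%:E)%E.
  by apply: eq_eseriesr => p _; rewrite dF.
rewrite (@nneseries_telescope _ _ 0) ?sub0r ?opprK//.
- case: n n0 {nR0 dF} @F => // n _ F.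
  have bin_cvg0 : ((fun p => ('C(n.+1 + p.-1, n.+1)%:R : R)^-1) @ \oo --> (0 : R))%classic.
    rewrite -cvg_shiftS; apply: (squeeze_cvgr _ (cvg_cst 0) cvg_harmonic).
    apply: nearW => p; rewrite invr_ge0 ler0n /= lef_pV2 ?posrE ?ltr0n//.
      by rewrite ler_nat ltn_bin_add.
    by rewrite bin_gt0 leq_addr.
  rewrite (_ : 0 = - (0 / n.+1%:R)); last by rewrite mul0r oppr0.
  by apply: cvgN; apply: cvgM bin_cvg0 _; exact: cvg_cst.
- apply/nondecreasing_seqP => p; rewrite -subr_ge0 -dF.
  by rewrite mulr_ge0 ?invr_ge0.
Qed.

Definition divn_seq {R : realType} (u : nat -> R) (n : nat) : R := u n / n%:R.

Lemma step_EssE (R : realType) e (u : nat -> R) n :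
  step e Ess u n = (n%:R ^+ e)^-1 * \sum_(m < n) u m.
Proof.
rewrite /step big_mkcond big_ord_recr /= ltnn addr0; congr (_ * _).
by apply: eq_bigr => m _; rewrite ltn_ord.
Qed.

Lemma step_EllE (R : realType) e (u : nat -> R) n :
  step e Ell u n = (n%:R ^+ e)^-1 * \sum_(m < n.+1) u m.
Proof. by rewrite /step; congr (_ * _); apply: eq_bigl => m /=; rewrite -ltnS ltn_ord. Qed.

Lemma step1_Ell (R : realType) (u : nat -> R) :
  step 1 Ell u = divn_seq u \+ step 1 Ess u.
Proof.
apply/funext => n /=; rewrite step_EllE step_EssE big_ord_recr /= mulrDr addrC.
by rewrite /divn_seq expr1 (mulrC (u n)).
Qed.

Lemma step2_Ell (R : realType) (u : nat -> R) :
  step 2 Ell u = divn_seq (step 1 Ell u).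
Proof.
by apply/funext => n; rewrite /divn_seq !step_EllE expr1 expr2 invfM mulrAC.
Qed.

Lemma step0 {R : realType} e a (u : nat -> R) : (0 < e)%N -> step e a u 0 = 0.
Proof. by move=> e0; rewrite /step expr0n gtn_eqF// invr0 mul0r. Qed.

Lemma pairing_term_ge0 (R : realType) (u v : nat -> R) n m :
  nonneg_seq u -> nonneg_seq v ->
  (0 <= (u n * v m / 'C(n + m, n)%:R)%:E)%E.
Proof. by move=> u0 v0; rewrite lee_fin !mulr_ge0// invr_ge0. Qed.

Lemma pairingC (R : realType) (u v : nat -> R) :
  nonneg_seq u -> nonneg_seq v -> pairing u v = pairing v u.
Proof.
move=> u0 v0; rewrite /pairing nneseries_interchange; last first.
  by move=> n m; exact: pairing_term_ge0.
apply: eq_eseriesr => m _; apply: eq_eseriesr => n _.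
by rewrite (mulrC (u n)) -bin_sub ?leq_addr// addKn addnC.
Qed.

Lemma pairingDl (R : realType) (u w v : nat -> R) :
  nonneg_seq u -> nonneg_seq w -> nonneg_seq v ->
  pairing (u \+ w) v = (pairing u v + pairing w v)%E.
Proof.
move=> u0 w0 v0; rewrite /pairing -nneseriesD; last 2 first.
- by move=> n _ _; apply: nneseries_ge0 => m _ _; exact: pairing_term_ge0.
- by move=> n _ _; apply: nneseries_ge0 => m _ _; exact: pairing_term_ge0.
apply: eq_eseriesr => n _; rewrite -nneseriesD; last 2 first.
- by move=> m _ _; exact: pairing_term_ge0.
- by move=> m _ _; exact: pairing_term_ge0.
by apply: eq_eseriesr => m _; rewrite -EFinD /= !mulrDl.
Qed.

(** Adjunction of X0 and X1: expand the factor 1 / n on the left by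
    [connector_sum] and sum over m < p first.  The hypothesis u 0 = 0 is needed
    since the left-hand side does not see u 0. *)
Lemma pairing_divn_step (R : realType) (u v : nat -> R) :
  nonneg_seq u -> nonneg_seq v -> u 0%N = 0 ->
  pairing (divn_seq u) v = pairing u (step 1 Ess v).
Proof.
move=> u0 v0 u00; apply: eq_eseriesr => n _.
case: (posnP n) => [->|n0].
  rewrite !eseries0// => m _ _; by rewrite /divn_seq u00 !mul0r.
transitivity (\sum_(m <oo) \sum_(p <oo)
    (if (m < p)%N then u n * v m * (('C(n + p, n)%:R)^-1 / p%:R) else 0)%:E)%E.
  apply: eq_eseriesr => m _.
  under eq_eseriesr => p _ do rewrite (fun_if EFin).
  rewrite -eseries_mkcond -ereal_series.
  under eq_eseriesr => p _ do rewrite EFinM.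
  rewrite nneseriesZl; last by move=> p _; rewrite lee_fin mulr_ge0 ?invr_ge0.
  by rewrite connector_sum// -EFinM /divn_seq; congr (_%:E); ring.
rewrite nneseries_interchange; last first.
  by move=> m p; rewrite lee_fin; case: ifP => // _; rewrite !mulr_ge0 ?invr_ge0.
apply: eq_eseriesr => p _; rewrite (nneseries_finsupp p); last 2 first.
- by move=> m; rewrite lee_fin; case: ifP => // _; rewrite !mulr_ge0 ?invr_ge0.
- by move=> m; rewrite leqNgt => /negbTE ->.
under eq_bigr => m _ do rewrite ltn_ord.
rewrite sumEFin step_EssE expr1 -mulr_suml -mulr_sumr; congr (_%:E).
by ring.
Qed.

Lemma divn_seq_ge0 (R : realType) (u : nat -> R) :
  nonneg_seq u -> nonneg_seq (divn_seq u).
Proof. by move=> u0 n; rewrite mulr_ge0 ?invr_ge0. Qed.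

Lemma pairing_step_divn (R : realType) (u v : nat -> R) :
  nonneg_seq u -> nonneg_seq v -> v 0%N = 0 ->
  pairing (step 1 Ess u) v = pairing u (divn_seq v).
Proof.
move=> u0 v0 v00; rewrite pairingC//; last exact: step_ge0.
by rewrite -pairing_divn_step// pairingC//; exact: divn_seq_ge0.
Qed.

Lemma pairing_step_Ell (R : realType) (u v : nat -> R) :
  nonneg_seq u -> nonneg_seq v -> u 0%N = 0 -> v 0%N = 0 ->
  pairing (step 1 Ell u) v = pairing u (step 1 Ell v).
Proof.
move=> u0 v0 u00 v00; have du := divn_seq_ge0 _ _ u0; have dv := divn_seq_ge0 _ _ v0.
have su : nonneg_seq (step 1 Ess u) by exact: step_ge0.
have sv : nonneg_seq (step 1 Ess v) by exact: step_ge0.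
rewrite !step1_Ell pairingDl// pairing_divn_step// pairing_step_divn//.
rewrite [in RHS]pairingC//; last by move=> n; rewrite addr_ge0.
by rewrite pairingDl// addeC pairingC// [X in (_ + X)%E]pairingC.
Qed.

Lemma pairing_delta0 (R : realType) (u : nat -> R) : nonneg_seq u ->
  pairing u (delta0 R) = (\sum_(n <oo) (u n)%:E)%E.
Proof.
move=> u0; apply: eq_eseriesr => n _; rewrite (nneseries_finsupp 1).
- by rewrite big_ord1 /delta0 addn0 binn mulr1 divr1.
- by move=> m; apply: pairing_term_ge0 => //; exact: delta0_ge0.
- by move=> [//|m] _; rewrite /delta0 mulr0 mul0r.
Qed.

Lemma step_delta0 (R : realType) e a n : (0 < e)%N ->
  step e a (delta0 R) n = n%:R ^- e.
Proof.
move=> e0; case: n => [|n]; first by rewrite step0// expr0n gtn_eqF// invr0.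
rewrite /step big_mkcond big_ord_recl /= big1 ?addr0; last first.
  by move=> m _; rewrite /delta0; case: ifP.
by rewrite (_ : letter_rel a n.+1 0) ?mulr1//; case: a.
Qed.

Lemma iter_step_ge0 (R : realType) (f : (nat -> R) -> nat -> R) u k :
  (forall w, nonneg_seq w -> nonneg_seq (f w)) ->
  nonneg_seq u -> nonneg_seq (iter k f u).
Proof. by move=> fP u0; elim: k => [//|k IH] /=; exact: fP. Qed.

(** One round moves Z, then X1, across the pairing, where they become Z, then
    X0; the two together are [step 2 Ell]. *)
Lemma pairing_iter (R : realType) k (u v : nat -> R) :
  nonneg_seq u -> nonneg_seq v -> v 0%N = 0 ->
  pairing (iter k (step 1 Ell \o step 1 Ess) u) v = pairing u (iter k (step 2 Ell) v).
Proof.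
move=> u0; elim: k v => [//|k IH] v v0 v00; rewrite [in RHS]iterSr -IH ?step0//; last first.
  exact: step_ge0.
have w0 : nonneg_seq (iter k (step 1 Ell \o step 1 Ess) u).
  by apply: iter_step_ge0 => // w w0; do 2 apply: step_ge0.
rewrite iterS /= pairing_step_Ell ?step0//; last exact: step_ge0.
by rewrite pairing_step_divn ?step0// ?step2_Ell//; exact: step_ge0.
Qed.

(** The left sum is the pairing with [delta0].  Its outermost X0 crosses first
    and becomes the innermost X1 on the other side; on [delta0] the strict and
    the weak summation agree. *)
Lemma sum_duality (R : realType) k : (0 < k)%N ->
  (\sum_(n <oo) (divn_seq (iter k (step 1 Ell \o step 1 Ess) (delta0 R)) n)%:E
   = \sum_(n <oo) (iter k (step 2 Ell) (step 1 Ell (delta0 R)) n)%:E)%E.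
Proof.
move=> k0; have d0 := delta0_ge0 R.
have w0 : nonneg_seq (iter k (step 1 Ell \o step 1 Ess) (delta0 R)).
  by apply: iter_step_ge0 => // w w0; do 2 apply: step_ge0.
rewrite -pairing_delta0; last exact: divn_seq_ge0.
rewrite pairing_divn_step//; last by case: k k0 {w0} => // k _; rewrite iterS /= step0.
rewrite pairing_iter ?step0//; last exact: step_ge0.
have -> : step 1 Ess (delta0 R) = step 1 Ell (delta0 R).
  by apply/funext => n; rewrite !step_delta0.
rewrite pairingC ?pairing_delta0//;
  by apply: iter_step_ge0; [move=> w ?; exact: step_ge0 | exact: step_ge0].
Qed.

(** * Ratios of binomial coefficients *)

(** This is n!^2 / ((n - j)! (n + j)!), extended by 0 to j > n. *)
Definition bin_ratio (R : realType) (n j : nat) : R := 'C(n, j)%:R / 'C(n + j, j)%:R.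

Lemma bin_ratio_ge0 (R : realType) n j : 0 <= bin_ratio R n j.
Proof. by rewrite mulr_ge0 ?invr_ge0. Qed.

Lemma bin_ratio0 (R : realType) n : bin_ratio R n 0 = 1.
Proof. by rewrite /bin_ratio !bin0 divr1. Qed.

Lemma bin_ratio_small (R : realType) n j : (n < j)%N -> bin_ratio R n j = 0.
Proof. by move=> nj; rewrite /bin_ratio bin_small ?mul0r. Qed.

Lemma bin_denom_neq0 (R : realType) n j : 'C(n + j, j)%:R != 0 :> R.
Proof. by rewrite pnatr_eq0 -lt0n bin_gt0 leq_addl. Qed.

Lemma bin_ratioSr (R : realType) n j :
  (n%:R + j.+1%:R) * bin_ratio R n j.+1 = (n%:R - j%:R) * bin_ratio R n j.
Proof.
have [nj|jn] := ltnP n j.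
  by rewrite !bin_ratio_small ?mulr0// leqW.
have /(congr1 (fun i => i%:R : R)) := mul_bin_left n j.
rewrite !natrM natrB// => E1.
have /(congr1 (fun i => i%:R : R)) := mul_bin_diag (n + j).+1 j.
rewrite !natrM /= -addnS natrD => E2.
have j0 : j.+1%:R != 0 :> R by rewrite pnatr_eq0.
have nj0 : n%:R + j.+1%:R != 0 :> R by rewrite -natrD addnS pnatr_eq0.
have C0 := bin_denom_neq0 R n j.
rewrite /bin_ratio -(canLR (mulKf j0) E2).
rewrite (canRL (mulKf j0) E1).
by field; rewrite nat1r C0 j0 nj0.
Qed.

Lemma bin_ratioSl (R : realType) n j :
  bin_ratio R n.+1 j - bin_ratio R n j = bin_ratio R n.+1 j * j%:R ^+ 2 / n.+1%:R ^+ 2.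
Proof.
have [nj|jn] := ltnP n.+1 j.
  by rewrite !bin_ratio_small ?subrr ?mul0r// ltnW.
have /(congr1 (fun i => i%:R : R)) := mul_bin_down n.+1 j.
rewrite !natrM natrB//= => E1.
have /(congr1 (fun i => i%:R : R)) := mul_bin_down (n.+1 + j) j.
rewrite addnK !natrM natrD /= => E2.
have n0 : n.+1%:R != 0 :> R by rewrite pnatr_eq0.
have nj0 : n.+1%:R + j%:R != 0 :> R by rewrite -natrD pnatr_eq0.
have C0 := bin_denom_neq0 R n j.
rewrite /bin_ratio -(canLR (mulKf n0) E2).
rewrite (canRL (mulKf n0) E1).
by field; rewrite nat1r C0 n0 nj0.
Qed.

(** By [bin_ratioSr], 2 j c(n, j) is the decrease of (n + j) c(n, j) from j to
    j + 1, so the sum telescopes; c(n, j) vanishes for j > n. *)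
Lemma sum_bin_ratio (R : realType) n N : (n < N)%N ->
  \sum_(j < N) (2 * j%:R * bin_ratio R n j) = n%:R.
Proof.
have H M : \sum_(j < M) (2 * j%:R * bin_ratio R n j) =
    n%:R - (n%:R + M%:R) * bin_ratio R n M.
  elim: M => [|M IH]; first by rewrite big_ord0 bin_ratio0 addr0 mulr1 subrr.
  by rewrite big_ord_recr /= IH bin_ratioSr; ring.
by move=> nN; rewrite H bin_ratio_small// mulr0 subr0.
Qed.

Lemma bin_ratio_divn2 (R : realType) n j : (0 < j)%N ->
  bin_ratio R n j / n%:R ^+ 2 =
  bin_ratio R n j / j%:R ^+ 2 - bin_ratio R n.-1 j / j%:R ^+ 2.
Proof.
move=> j0; case: n => [|n]; first by rewrite bin_ratio_small ?mul0r ?subrr.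
rewrite -mulrBl bin_ratioSl.
have jR0 : j%:R != 0 :> R by rewrite pnatr_eq0 -lt0n.
by field; rewrite nat1r jR0 pnatr_eq0.
Qed.

Lemma partial_sum_bin_ratio (R : realType) n j : (0 < j)%N ->
  \sum_(m < n.+1) bin_ratio R m j / m%:R ^+ 2 = bin_ratio R n j / j%:R ^+ 2.
Proof.
move=> j0; elim: n => [|n IH].
  by rewrite big_ord1 /= bin_ratio_small ?mul0r.
by rewrite big_ord_recr /= IH (bin_ratio_divn2 _ n.+1)//= addrC subrK.
Qed.

(** By [bin_ratioSr], c(n, j + 1) is c(n, j) multiplied by
    (n - j) / (n + j + 1) = 1 - (2 j + 1) / (n + j + 1). *)
Lemma bin_ratio_cvg1 (R : realType) j : ((bin_ratio R)^~ j @ \oo --> (1 : R))%classic.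
Proof.
elim: j => [|j IH].
  under eq_fun do rewrite bin_ratio0.
  exact: cvg_cst.
rewrite (_ : (bin_ratio R)^~ j.+1 = (fun n =>
    bin_ratio R n j * (1 - (j.*2.+1)%:R * harmonic (n + j)%N))); last first.
  apply/funext => n.
  have nj0 : n%:R + j.+1%:R != 0 :> R by rewrite -natrD addnS pnatr_eq0.
  apply: (mulfI nj0); rewrite bin_ratioSr /= -addnS natrD -addnn -addSn natrD.
  by field; rewrite nat1r nj0.
have h : ((fun n => 1 - j.*2.+1%:R * harmonic (n + j)%N) @ \oo -->
    (1 - j.*2.+1%:R * 0 : R))%classic.
  apply: cvgB; first exact: cvg_cst.
  apply: cvgM; first exact: cvg_cst.
  by have := @cvg_harmonic R; rewrite -(cvg_shiftn j).
have := cvgM IH h; rewrite mulr0 subr0 mulr1; exact.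
Qed.

Lemma series_bin_ratio (R : realType) j : (0 < j)%N ->
  (\sum_(n <oo) (bin_ratio R n j / n%:R ^+ 2)%:E = (j%:R ^- 2)%:E)%E.
Proof.
move=> j0; pose F n : R := bin_ratio R n.-1 j / j%:R ^+ 2.
have dF n : bin_ratio R n j / n%:R ^+ 2 = F n.+1 - F n by exact: bin_ratio_divn2.
under eq_eseriesr do rewrite dF.
rewrite (@nneseries_telescope _ _ (j%:R ^- 2)).
- by rewrite {1}/F /= bin_ratio_small// mul0r subr0.
- rewrite -cvg_shiftS.
  rewrite (_ : j%:R ^- 2 = 1 * j%:R ^- 2); last by rewrite mul1r.
  by apply: cvgM (bin_ratio_cvg1 R j) _; exact: cvg_cst.
- apply/nondecreasing_seqP => n; rewrite -subr_ge0 -dF.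
  by rewrite mulr_ge0 ?bin_ratio_ge0// invr_ge0 exprn_ge0.
Qed.

(** * The value of the star series *)

(** For j > 0 this is 2 / j^(2k-1); the form with 2k in the exponent also makes
    sense for k = 0, where the induction starts. *)
Definition odd_summand {R : realType} (k j : nat) : R := 2 * j%:R / (j%:R ^+ 2) ^+ k.

(** The case k = 0 is [sum_bin_ratio] divided by n^2; each further [step 2 Ell]
    sums c(m, j) / m^2 over m <= n, which telescopes to c(n, j) / j^2.  Any
    bound N > n gives the same sum, and a common N for all m <= n lets the two
    finite sums be exchanged. *)
Lemma iter_step2_bin_ratio (R : realType) k n N : (n < N)%N ->
  iter k (step 2 Ell) (step 1 Ell (delta0 R)) n =
  \sum_(j < N) odd_summand k j * (bin_ratio R n j / n%:R ^+ 2).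
Proof.
elim: k n => [|k IH] n nN.
  rewrite /= step_delta0// expr1 /odd_summand.
  under eq_bigr => j _ do rewrite expr0 divr1 mulrA.
  rewrite -mulr_suml sum_bin_ratio//; case: n {nN} => [|n]; first by rewrite invr0 mul0r.
  by field; rewrite nat1r pnatr_eq0.
rewrite iterS step_EllE; under eq_bigr => m _.
  rewrite IH; last exact: leq_trans (ltn_ord m) nN.
  over.
rewrite exchange_big mulr_sumr; apply: eq_bigr => j _ /=.
(* The telescoping fails at j = 0, where the factor 2 j vanishes. *)
rewrite -mulr_sumr; case: (posnP j) => [->|j0].
  by rewrite /odd_summand mulr0 !mul0r mulr0.
rewrite partial_sum_bin_ratio// /odd_summand [_ ^+ k.+1]exprSr [(_ ^+ k * _)^-1]invfM.
by ring.
Qed.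

(** Convergence follows by comparing 1 / j^s with 2 / (j (j + 1)), which is
    summable by [connector_sum] at n = 1, m = 0. *)
Lemma zetaE (R : realType) s : (1 < s)%N ->
  ((\sum_(j <oo) (j.+1%:R ^- s : R)%:E)%E = (zeta R s)%:E)%E.
Proof.
move=> s1; have cv : cvgn (series (fun j : nat => j.+1%:R ^- s : R)).
  apply: nnseries_is_cvg => [j|]; first by rewrite invr_ge0 exprn_ge0.
  apply: (@le_lt_trans _ _ (\sum_(j <oo) (2 * (('C(1 + j.+1, 1)%:R)^-1 / j.+1%:R) : R)%:E)%E).
    apply: lee_nneseries => j _; first by rewrite lee_fin invr_ge0 exprn_ge0.
    rewrite lee_fin bin1 -invfM.
    rewrite ler_pdivlMr ?mulr_gt0 ?ltr0n// mulrC ler_pdivrMr ?exprn_gt0 ?ltr0n//.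
    rewrite -natrX -!natrM ler_nat (@leq_trans (2 * j.+1 ^ 2))//.
      by rewrite expnS expn1 mulnA leq_mul2r mul2n -addnn leq_add2r.
    by rewrite leq_mul2l leq_pexp2l.
  under eq_eseriesr do rewrite EFinM.
  rewrite nneseriesZl; last by move=> j _; rewrite lee_fin mulr_ge0 ?invr_ge0.
  rewrite (_ : (\sum_(j <oo) _)%E =
      \sum_(1 <= p <oo) (('C(1 + p, 1)%:R : R)^-1 / p%:R)%:E)%E.
    by rewrite connector_sum// -EFinM ltry.
  rewrite -[RHS]nneseries_addn; first by apply: eq_eseriesr => j _; rewrite addn1.
  by move=> j; rewrite lee_fin mulr_ge0 ?invr_ge0.
rewrite -EFin_lim//; congr (limn _); apply/funext => n.
by rewrite /= sumEFin.
Qed.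

Lemma odd_summandE (R : realType) k j : (0 < j)%N ->
  odd_summand k j / j%:R ^+ 2 = 2 * j%:R ^- (2 * k + 1)%N :> R.
Proof.
move=> j0; have jR0 : j%:R != 0 :> R by rewrite pnatr_eq0 -lt0n.
rewrite /odd_summand -exprM exprD expr1.
have : j%:R ^+ (2 * k) != 0 :> R by rewrite expf_neq0.
by move: (_ ^+ (2 * k)) => x x0; field; rewrite jR0 x0.
Qed.

Lemma sum_star_2_1 (R : realType) k : (0 < k)%N ->
  (\sum_(n <oo) (iter k (step 2 Ell) (step 1 Ell (delta0 R)) n)%:E =
  (2 * zeta R (2 * k + 1))%:E)%E.
Proof.
move=> k0.
have os0 j : 0 <= odd_summand k j :> R.
  by rewrite !mulr_ge0// invr_ge0 !exprn_ge0.
have t0 n j : (0 <= (odd_summand k j * (bin_ratio R n j / n%:R ^+ 2))%:E)%E.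
  by rewrite lee_fin !mulr_ge0 ?bin_ratio_ge0 ?invr_ge0 ?exprn_ge0.
transitivity (\sum_(n <oo) \sum_(j <oo)
    (odd_summand k j * (bin_ratio R n j / n%:R ^+ 2))%:E)%E.
  apply: eq_eseriesr => n _; rewrite (iter_step2_bin_ratio _ _ _ n.+1)//.
  rewrite (nneseries_finsupp n.+1) ?sumEFin// => j nj.
  by rewrite bin_ratio_small// mul0r mulr0.
rewrite nneseries_interchange//.
transitivity (\sum_(j <oo) (2 * j%:R ^- (2 * k + 1)%N : R)%:E)%E.
  apply: eq_eseriesr => j _; case: (posnP j) => [->|j0].
    rewrite eseries0 ?expr0n ?addn1 ?invr0 ?mulr0// => n _ _.
    by rewrite /odd_summand mulr0 !mul0r.
  under eq_eseriesr do rewrite EFinM.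
  rewrite nneseriesZl; last first.
    by move=> n _; rewrite lee_fin mulr_ge0 ?bin_ratio_ge0// invr_ge0 exprn_ge0.
  by rewrite series_bin_ratio// -EFinM odd_summandE.
under eq_eseriesr do rewrite EFinM.
rewrite nneseriesZl; last by move=> j _; rewrite lee_fin invr_ge0 exprn_ge0.
rewrite EFinM -zetaE; last by rewrite addn1 ltnS muln_gt0.
congr (_ * _)%E; rewrite nneseries_recl//=.
  rewrite expr0n addn1 invr0 add0e -[LHS]nneseries_addn.
    by apply: eq_eseriesr => j _; rewrite addn1.
  by move=> j; rewrite lee_fin invr_ge0 exprn_ge0.
Qed.

(** * The two words as iterated operators *)

Lemma coef_star_2_1 (R : realType) k :
  coef R (rep k [:: 2%N] ++ [:: 1%N]) (rep k [:: Ell]) =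
  iter k (step 2 Ell) (step 1 Ell (delta0 R)).
Proof. by elim: k => [//|k IH]; rewrite /= -IH. Qed.

Lemma coef_alternating (R : realType) j :
  coef R (1%N :: rep j.*2 [:: 1%N]) (rep j [:: Ess; Ell]) =
  step 1 Ess (iter j (step 1 Ell \o step 1 Ess) (delta0 R)).
Proof.
elim: j => [|j IH]; first by apply/funext => n; rewrite /= !step_delta0.
by rewrite iterS [RHS]/= -IH.
Qed.

Lemma coef_2_1s (R : realType) k : (0 < k)%N ->
  coef R (2%N :: rep (2 * k - 1) [:: 1%N]) (rep (k - 1) [:: Ell; Ess] ++ [:: Ell]) =
  divn_seq (iter k (step 1 Ell \o step 1 Ess) (delta0 R)).
Proof.
case: k => // k _; rewrite subn1 mul2n doubleS subn1 /=.
have -> : rep k [:: Ell; Ess] ++ [:: Ell] = Ell :: rep k [:: Ess; Ell].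
  by elim: k => [//|k IH] /=; rewrite IH.
by rewrite /= -step2_Ell -coef_alternating.
Qed.

Lemma all_rep (T : Type) (P : pred T) j w : all P w -> all P (rep j w).
Proof. by move=> Pw; elim: j => [//|j IH]; rewrite /rep /= all_cat Pw. Qed.

Theorem proposition1 (R : realType) (k : nat) (hk : (1 <= k)%N) :
  mzv R (2%N :: rep (2 * k - 1) [:: 1%N]) (rep (k - 1) [:: Ell; Ess] ++ [:: Ell])
    = mzv R (rep k [:: 2%N] ++ [:: 1%N]) (rep k [:: Ell])
  /\ mzv R (rep k [:: 2%N] ++ [:: 1%N]) (rep k [:: Ell])
    = (2 * zeta R (2 * k + 1))%:E.
Proof.
have pos1 : all (leq 1) (2%N :: rep (2 * k - 1) [:: 1%N]) by rewrite /= all_rep.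
have pos2 : all (leq 1) (rep k [:: 2%N] ++ [:: 1%N]) by rewrite all_cat all_rep.
rewrite !mzvE// coef_2_1s// coef_star_2_1; split; first exact: sum_duality.
exact: sum_star_2_1.
Qed.
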